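(* Let $Y$ be a smooth manifold. (1) For any smooth function $F:TY\to\mathbb{R}$, the chart expressions $$\eta=\frac{\partial F}{\partial\dot y^\nu}\,dy^\nu$$ (summation over $\nu$) define a global $1$-form $\eta$ on $TY$. (2) If $F$ satisfies the homogeneity condition $F(\lambda\xi)=\lambda F(\xi)$ for all tangent vectors $\xi\in TY$ and every real $\lambda>0$, then $\eta$ is projectable on the Grassmann fibration $G^1Y$. (3) If $F$ satisfies the homogeneity condition, then for any curve $\zeta:I\to Y$, $$(\Lambda^1\zeta)^*\eta=(F\circ\Lambda^1\zeta)\,dt .$$
   Context: For a chart $(V,\psi)$, $\psi=(y^\sigma)$, on $Y$, $(y^\sigma,\dot y^\sigma)$ denotes the associated chart on $TY=\Lambda^1TY$ (over $V$), where $\dot y^\sigma$ are the components of a tangent vector with respect to $\partial/\partial y^\sigma$. The Grassmann fibration $G^1Y$ (of degree $1$) is the quotient of the set $\Lambda^1_0TY\subset TY$ of non-zero tangent vectors by the equivalence relation ''$\xi_1$ is equivalent with $\xi_2$ if there exists a real number $\lambda>0$ such that $\xi_1=\lambda\xi_2$''; it is a fibration over $Y$, and $\kappa^1:\Lambda^1_0TY\to G^1Y$ denotes the quotient projection. That $\eta$ is projectable on $G^1Y$ means that there is a $1$-form $\tilde\eta$ on $G^1Y$ such that $(\kappa^1)^*\tilde\eta=\eta$ on $\Lambda^1_0TY$. A curve $\zeta:I\to Y$ is a differentiable mapping of an open interval $I\subset\mathbb{R}$ with canonical coordinate $t$; its canonical lift is $\Lambda^1\zeta:I\to TY$, $\Lambda^1\zeta(t)=T_t\zeta\cdot(\partial/\partial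 t)_t$, i.e. the velocity curve of $\zeta$. *)

(* Defs.v *)
(* MathComp-Analysis. *)
From HB Require Import structures.
From mathcomp Require Import all_boot all_order all_algebra generic_quotient.
From mathcomp Require Import all_classical all_reals all_analysis.

Set Implicit Arguments.
Unset Strict Implicit.
Unset Printing Implicit Defensive.
Import Order.TTheory GRing.Theory Num.Theory.
Import numFieldNormedType.Exports.
Local Open Scope classical_set_scope.
Local Open Scope ring_scope.
Local Open Scope quotient_scope.

Section Smooth.
Context {R : realType} {V W : normedModType R}.

(* For U open in finite dimension, this is the usual C^k: the second clause asks
   the differential of f, evaluated at each fixed vector, to be C^(k-1). *)
Fixpoint Ck (k : nat) (U : set V) (f : V -> W) : Prop :=
  match k with
  | 0%N => forall x, U x -> {for x, continuous f}
  | k'.+1 => (forall x, U x -> differentiable f x) /\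
             (forall v, Ck k' U ('D_v f))
  end.

Definition smooth (U : set V) (f : V -> W) : Prop := forall k, Ck k U f.

End Smooth.

Section SmoothTheory.
Context {R : realType} {V : normedModType R}.
Implicit Types (U : set V) (W : normedModType R).

Lemma near_eq_differentiable W (f g : V -> W) x :
  (\near x, f x = g x) -> differentiable f x -> differentiable g x.
Proof.
move=> fg df; apply/diffP => /=.
apply: (@getPex _ (fun (dg : {linear V -> W}) => continuous dg /\
  forall y, g y = g (lim (nbhs x)) + dg (y - lim (nbhs x))
                  +o_(y \near x) (y - lim (nbhs x)))).
have /diffP [dc /funext dfE] := df.
move: dfE => /eqaddoP dE.
exists ('d f x); split=> //.
have : forall e : R, 0 < e -> \forall y \near nbhs_filter_on x,
    `|(g - (fun y => g (lim (nbhs_filter_on x)) +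
           'd f x (y - lim (nbhs_filter_on x)))) y|
    <= e * `|y - lim (nbhs_filter_on x)|; last first.
  by move=> /eqaddoP gE; apply: eqaddoEx => y; rewrite {1}gE.
move=> _/posnumP[e]; have := dE _ (gt0 e).
rewrite !lim_id // (nbhs_singleton fg) => dE'.
near=> y; rewrite /= !fctE -(near fg y) //; near: y; exact: dE'.
Unshelve. all: by end_near. Qed.

Lemma Ck_eq W k U (f g : V -> W) : open U -> (forall x, U x -> f x = g x) ->
  Ck k U f -> Ck k U g.
Proof.
move=> oU; elim: k f g => [|k IH] f g fg /=.
  move=> fc x Ux; have nfg : \forall y \near x, f y = g y.
    by apply: filterS (open_nbhs_nbhs (conj oU Ux)) => y; exact: fg.
  have := fc x Ux; rewrite /prop_for /continuous_at -(fg _ Ux) => fx.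
  by apply: cvg_trans fx; apply: near_eq_cvg; apply: filterS nfg.
have nfg x : U x -> \forall y \near x, f y = g y.
  by move=> Ux; apply: filterS (open_nbhs_nbhs (conj oU Ux)) => y; exact: fg.
move=> [fd fD]; split=> [x Ux|v].
  by apply: (near_eq_differentiable (nfg _ Ux)); exact: fd.
by apply: IH (fD v) => x Ux; apply: near_eq_derive; exact: nfg.
Qed.

Lemma Ck_sub W k U U' (f : V -> W) : U' `<=` U -> Ck k U f -> Ck k U' f.
Proof.
move=> s; elim: k f => [|k IH] f /=; first by move=> h x /s; exact: h.
by move=> [h1 h2]; split=> [x /s|v]; [exact: h1 | exact: IH].
Qed.

Lemma Ck_pred W k U (f : V -> W) : Ck k.+1 U f -> Ck k U f.
Proof.
elim: k f => [|k IH] f.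
  by move=> [h _] x Ux; apply: differentiable_continuous; exact: h.
by move=> [h1 h2]; split=> // v; apply: IH.
Qed.

Lemma Ck_cst W k U (w : W) : Ck k U (cst w).
Proof.
elim: k w => [|k IH] w /=; first by move=> x _; exact: cst_continuous.
split=> [x _|v]; first exact: differentiable_cst.
by rewrite (_ : 'D_v (cst w) = cst 0) //; apply/funext => x; rewrite derive_cst.
Qed.

Lemma Ck_add W k U (f g : V -> W) : open U -> Ck k U f -> Ck k U g ->
  Ck k U (f + g).
Proof.
move=> oU; elim: k f g => [|k IH] f g /=.
  by move=> cf cg x Ux; apply: continuousD; [exact: cf|exact: cg].
move=> [f1 f2] [g1 g2]; split=> [x Ux|v].
  by apply: differentiableD; [exact: f1|exact: g1].
apply: (@Ck_eq _ _ _ ('D_v f + 'D_v g)) => // [x Ux|]; last exact: IH.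
by rewrite deriveD //; apply: diff_derivable; [exact: f1|exact: g1].
Qed.

Lemma Ck_sum W k U n (f : 'I_n -> V -> W) : open U -> (forall i, Ck k U (f i)) ->
  Ck k U (\sum_i f i).
Proof.
move=> oU h; elim/big_ind: _ => //; first exact: Ck_cst.
by move=> g1 g2 h1 h2; apply: Ck_add.
Qed.

Lemma Ck_lin W W' k U (L : {linear W -> W'}) (f : V -> W) : open U ->
  continuous L -> Ck k U f -> Ck k U (L \o f).
Proof.
move=> oU cL; elim: k f => [|k IH] f /=.
  by move=> cf x Ux; apply: continuous_comp; [exact: cf|exact: cL].
move=> [f1 f2].
have dL y : differentiable L y by exact: linear_differentiable.
split=> [x Ux|v]; first by apply: differentiable_comp => //; exact: f1.
apply: (@Ck_eq _ _ _ (L \o 'D_v f)) => // [x Ux|]; last exact: IH.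
rewrite (deriveE _ (differentiable_comp (f1 _ Ux) (dL _))).
rewrite diff_comp //=; last exact: f1.
rewrite diff_lin // deriveE //; exact: f1.
Qed.

Lemma Ck_mul k U (f g : V -> R) : open U -> Ck k U f -> Ck k U g ->
  Ck k U (f * g).
Proof.
move=> oU; elim: k f g => [|k IH] f g.
  by move=> cf cg x Ux; apply: continuousM; [exact: cf|exact: cg].
move=> cf cg; have [f1 f2] := cf; have [g1 g2] := cg.
split=> [x Ux|v]; first by apply: differentiableM; [exact: f1|exact: g1].
apply: (@Ck_eq _ _ _ (f * 'D_v g + g * 'D_v f)) => // [x Ux|].
  by rewrite deriveM //; apply: diff_derivable; [exact: f1|exact: g1].
by apply: Ck_add => //; apply: IH => //;
  [exact: Ck_pred cf|exact: g2|exact: Ck_pred cg|exact: f2].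
Qed.

Lemma Ck_inv k U (f : V -> R) : open U -> (forall x, U x -> f x != 0) ->
  Ck k U f -> Ck k U (fun x => (f x)^-1).
Proof.
move=> oU f0; elim: k => [|k IH].
  by move=> cf x Ux; apply: continuousV; [exact: f0|exact: cf].
move=> cf; have [f1 f2] := cf; have iV := IH (Ck_pred cf).
split=> [x Ux|v]; first by apply: differentiableV; [exact: f1|exact: f0].
apply: (@Ck_eq _ _ _ (cst (-1) *
    ((fun x => (f x)^-1) * (fun x => (f x)^-1)) * 'D_v f)) => // [x Ux|].
  rewrite deriveV; [|exact: f0|by apply: diff_derivable; exact: f1].
  by rewrite [RHS]/= !fctE /cst -[LHS]/(_ * _) expr2 invfM mulN1r.
apply: Ck_mul => //; last exact: f2.
by apply: Ck_mul => //; [exact: Ck_cst|exact: Ck_mul].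
Qed.

Lemma Ck_entry k U m n (f : V -> 'M[R]_(m, n)) i j : open U -> Ck k U f ->
  Ck k U (fun x => f x i j).
Proof.
move=> oU cf.
have @L : {linear 'M[R]_(m, n) -> R}.
  by exists (fun N : 'M[R]_(_, _) => N i j); do 2![eexists]; do ?[constructor];
     rewrite ?mxE// => ? *; rewrite ?mxE//; move=> ?; rewrite !mxE.
by apply: (@Ck_lin _ _ k U L f) => //; exact: coord_continuous.
Qed.

Lemma Ck_mx k U m n (f : V -> 'M[R]_(m, n)) : open U ->
  (forall i j, Ck k U (fun x => f x i j)) -> Ck k U f.
Proof.
move=> oU h.
have -> : f = \sum_i \sum_j (fun x => f x i j *: delta_mx i j).
  apply/funext => x; rewrite {1}[f x]matrix_sum_delta fct_sumE.
  by apply: eq_bigr => i _; rewrite fct_sumE.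
apply: Ck_sum => // i; apply: Ck_sum => // j.
have sx_lin : linear (fun r : R => r *: delta_mx i j : 'M[R]_(m, n)).
  by move=> a b c; rewrite /= scalerDl scalerA.
pose sxlM := GRing.isLinear.Build _ _ _ _ _ sx_lin.
pose sxL : {linear _ -> _} :=
  HB.pack (fun r : R => r *: delta_mx i j : 'M[R]_(m, n)) sxlM.
by apply: (@Ck_lin _ _ k U sxL) => //; exact: scalel_continuous.
Qed.
End SmoothTheory.

Section SmoothComp.
Context {R : realType} {V : normedModType R}.

Lemma Ck_compR k m (U : set V) (U' : set 'rV[R]_m) (f : V -> 'rV[R]_m)
    (g : 'rV[R]_m -> R) :
  open U -> open U' -> (forall x, U x -> U' (f x)) ->
  Ck k U f -> Ck k U' g -> Ck k U (g \o f).
Proof.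
move=> oU oU' UU'; elim: k g => [|k IH] g.
  move=> cf cg x Ux; apply: continuous_comp; first exact: cf.
  by apply: cg; exact: UU'.
move=> cf cg; have [f1 f2] := cf; have [g1 g2] := cg.
split=> [x Ux|v].
  by apply: differentiable_comp; [exact: f1|apply: g1; exact: UU'].
apply: (@Ck_eq _ _ _ _ _ (\sum_i (fun x => 'D_v f x 0 i) *
    ('D_(delta_mx 0 i) g \o f))) => // [x Ux|].
  have gd := g1 _ (UU' _ Ux).
  rewrite deriveE; last by apply: differentiable_comp => //; exact: f1.
  rewrite diff_comp //; last exact: f1.
  rewrite /= -(deriveE _ (f1 _ Ux)) {1}['D_v f x]row_sum_delta linear_sum.
  rewrite fct_sumE; apply: eq_bigr => i _.
  by rewrite linearZ /= -deriveE.
apply: Ck_sum => // i; apply: Ck_mul => //.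
  by apply: Ck_entry => //; exact: f2.
by apply: IH => //; [exact: Ck_pred cf|exact: g2].
Qed.

Lemma Ck_comp k m p q (U : set V) (U' : set 'rV[R]_m) (f : V -> 'rV[R]_m)
    (g : 'rV[R]_m -> 'M[R]_(p, q)) :
  open U -> open U' -> (forall x, U x -> U' (f x)) ->
  Ck k U f -> Ck k U' g -> Ck k U (g \o f).
Proof.
move=> oU oU' UU' cf cg; apply: Ck_mx => // i j.
apply: (@Ck_compR _ _ _ U' f (fun x => g x i j)) => //.
exact: Ck_entry.
Qed.

Lemma Ck_mulmx k m p q (U : set V) (f : V -> 'M[R]_(m, p))
    (g : V -> 'M[R]_(p, q)) : open U ->
  Ck k U f -> Ck k U g -> Ck k U (fun x => f x *m g x).
Proof.
move=> oU cf cg; apply: Ck_mx => // i j.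
rewrite (_ : (fun _ => _) = \sum_l (fun x => f x i l) * (fun x => g x l j)).
  by apply: Ck_sum => // l; apply: Ck_mul => //; exact: Ck_entry.
by apply/funext => x; rewrite mxE fct_sumE.
Qed.

Lemma Ck_row_mx k m p q (U : set V) (f : V -> 'M[R]_(m, p))
    (g : V -> 'M[R]_(m, q)) : open U ->
  Ck k U f -> Ck k U g -> Ck k U (fun x => row_mx (f x) (g x)).
Proof.
move=> oU cf cg; apply: Ck_mx => // i j.
rewrite (_ : (fun _ => _) = fun x => match fintype.split j with
  inl l => f x i l | inr l => g x i l end).
  by case: (fintype.split j) => l; exact: Ck_entry.
by apply/funext => x; rewrite mxE.
Qed.

Lemma Ck_lsubmx k m p q (U : set V) (f : V -> 'M[R]_(m, p + q)) : open U ->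
  Ck k U f -> Ck k U (fun x => lsubmx (f x)).
Proof.
move=> oU cf; apply: Ck_mx => // i j.
rewrite (_ : (fun _ => _) = fun x => f x i (lshift q j)); first exact: Ck_entry.
by apply/funext => x; rewrite mxE.
Qed.

Lemma Ck_rsubmx k m p q (U : set V) (f : V -> 'M[R]_(m, p + q)) : open U ->
  Ck k U f -> Ck k U (fun x => rsubmx (f x)).
Proof.
move=> oU cf; apply: Ck_mx => // i j.
rewrite (_ : (fun _ => _) = fun x => f x i (rshift p j)); first exact: Ck_entry.
by apply/funext => x; rewrite mxE.
Qed.

Lemma Ck_id k m (U : set 'rV[R]_m) : open U -> Ck k U (@id 'rV[R]_m).
Proof.
case: k => [|k] oU; first by move=> x _; exact: cvg_id.
split=> [x _|v]; first exact: ex_diff.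
rewrite (_ : 'D_v id = cst v); first exact: Ck_cst.
by apply/funext => x; rewrite derive_id.
Qed.

Lemma Ck_jacobian k n m (U : set 'rV[R]_n) (f : 'rV[R]_n -> 'rV[R]_m) :
  open U -> Ck k.+1 U f -> Ck k U (fun x => 'J f x).
Proof.
move=> oU [f1 f2]; apply: Ck_mx => // i j.
apply: (@Ck_eq _ _ _ _ _ (fun x => 'D_(delta_mx 0 i) f x 0 j)) => // [x Ux|].
  rewrite deriveEjacobian; last exact: f1.
  by rewrite -[_ *m _](rowE i) mxE.
by apply: Ck_entry => //; exact: f2.
Qed.

End SmoothComp.

(* For phi injective on D, this is f \o phi^-1 on the image of D, and 0 off it. *)
Definition local_expr (T V : Type) (W : nmodType) (D : set T) (phi : T -> V)
    (f : T -> W) (x : V) : W :=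
  match pselect (exists2 p, D p & phi p = x) with
  | left h => f (projT1 (cid2 h))
  | right _ => 0
  end.

Lemma local_exprE (T V : Type) (W : nmodType) (D : set T) (phi : T -> V)
    (f : T -> W) (p : T) :
  (forall p q, D p -> D q -> phi p = phi q -> p = q) ->
  D p -> local_expr D phi f (phi p) = f p.
Proof.
move=> inj Dp; rewrite /local_expr; case: pselect => [h|[]]; last by exists p.
by case: cid2 => q Dq /= /inj ->.
Qed.

(* A set with a smooth atlas, which need not be maximal. Its topology is the one
   induced by the atlas, see atlas_open; the Hausdorff and second countability
   axioms are not part of the structure. *)
Record manifold (R : realType) (n : nat) := Manifold {
  carrier :> Type;
  chart : Type;
  dom : chart -> set carrier;
  coord : chart -> carrier -> 'rV[R]_n;
  dom_cover : forall p, exists c, dom c p;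
  coord_inj : forall c p q, dom c p -> dom c q -> coord c p = coord c q -> p = q;
  overlap_open : forall c d, open (coord c @` (dom c `&` dom d));
  transition_smooth : forall c d, smooth (coord c @` (dom c `&` dom d))
    (local_expr (dom c) (coord c) (coord d))
}.
Arguments dom {R n m}.
Arguments coord {R n m}.
Arguments overlap_open {R n m} c d.
Arguments transition_smooth {R n m} c d k.

HB.instance Definition _ R n (M : manifold R n) := gen_eqMixin (carrier M).
HB.instance Definition _ R n (M : manifold R n) := gen_choiceMixin (carrier M).

Definition atlas_open R n (M : manifold R n) (A : set M) : Prop :=
  forall c, open (coord c @` (A `&` dom c)).

Section AtlasTopology.
Context {R : realType} {n : nat} (M : manifold R n).

Lemma dom_image_open (c : chart M) : open (coord c @` dom c).
Proof. by have := overlap_open c c; rewrite setIid. Qed.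

Lemma atlas_openT : atlas_open [set: M].
Proof. by move=> c; rewrite setTI; exact: dom_image_open. Qed.

Lemma image_domI (c : chart M) (A B : set M) :
  coord c @` ((A `&` B) `&` dom c) =
  coord c @` (A `&` dom c) `&` coord c @` (B `&` dom c).
Proof.
apply/seteqP; split=> [_ [p [[Ap Bp] cp] <-]|].
  by split; exists p.
move=> _ [[p [Ap cp] <-]] [q [Bq cq] /(coord_inj cq cp) qp].
by exists p => //; split=> //; split=> //; rewrite -qp.
Qed.

Lemma atlas_openI : setI_closed (@atlas_open R n M).
Proof. by move=> A B oA oB c; rewrite image_domI; exact: openI. Qed.

Lemma atlas_open_bigU (I : Type) (f : I -> set M) :
  (forall i, atlas_open (f i)) -> atlas_open (\bigcup_i f i).
Proof.
move=> of_ c; rewrite setI_bigcupl image_bigcup.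
by apply: bigcup_open => i _; exact: of_.
Qed.

HB.instance Definition _ := isOpenTopological.Build (carrier M)
  atlas_openT atlas_openI atlas_open_bigU.

End AtlasTopology.

Definition smooth_fun R n (M : manifold R n) (f : M -> R) : Prop :=
  forall c : chart M,
    smooth (coord c @` dom c) (local_expr (dom c) (coord c) f).

Definition differentiable_map R m n (M : manifold R m) (N : manifold R n)
    (f : M -> N) : Prop :=
  continuous f /\
  forall (c : chart M) (d : chart N) x, dom c x -> dom d (f x) ->
    differentiable (local_expr (dom c) (coord c) (coord d \o f)) (coord c x).

Section Tangent.
Context {R : realType} {n : nat} {M : manifold R n}.
Implicit Types (c d e : chart M) (p : M).

Definition transition c d : 'rV[R]_n -> 'rV[R]_n :=
  local_expr (dom c) (coord c) (coord d).

(* A tangent vector at p is the family of its components with respect to the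
   coordinate bases of all charts at p (as a row vector, hence the position of the
   Jacobian); the value at a chart whose domain does not contain p is junk, set to
   0 so that equality of tangent vectors is Leibniz equality. *)
Record tangent (p : M) := Tangent {
  tcomp : chart M -> 'rV[R]_n;
  comp_out : forall c, ~ dom c p -> tcomp c = 0;
  comp_change : forall c d, dom c p -> dom d p ->
    tcomp d = tcomp c *m 'J (transition c d) (coord c p)
}.

Lemma transitionE c d p : dom c p -> transition c d (coord c p) = coord d p.
Proof. by move=> cp; apply: local_exprE => //; exact: coord_inj. Qed.

Lemma transition_differentiable c d p : dom c p -> dom d p ->
  differentiable (transition c d) (coord c p).
Proof.
by move=> cp dp; have [h _] := transition_smooth c d 1; apply: h; exists p.
Qed.

Lemma jacobian_transition_id c p : dom c p ->
  'J (transition c c) (coord c p) = 1%:M.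
Proof.
move=> cp; apply/row_matrixP => i; rewrite !rowE.
rewrite -deriveEjacobian; last exact: transition_differentiable.
rewrite (@near_eq_derive _ _ _ _ id); first by rewrite derive_id mulmx1.
have : nbhs (coord c p) (coord c @` dom c).
  by apply: open_nbhs_nbhs; split; [exact: dom_image_open|exists p].
by apply: filterS => _ [q cq <-]; rewrite transitionE.
Qed.

Lemma jacobian_transition_comp c d e p : dom c p -> dom d p -> dom e p ->
  'J (transition c e) (coord c p) =
  'J (transition c d) (coord c p) *m 'J (transition d e) (coord d p).
Proof.
move=> cp dp ep; apply/row_matrixP => i; rewrite !rowE mulmxA.
set f := transition c d; set g := transition d e; set h := transition c e.
set x := coord c p.
have df : differentiable f x by exact: transition_differentiable.
have dh : differentiable h x by exact: transition_differentiable.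
have fx : f x = coord d p by exact: transitionE.
have dg : differentiable g (f x).
  by rewrite fx; exact: transition_differentiable.
have hgf : \near x, h x = (g \o f) x.
  have : nbhs x (coord c @` (dom c `&` dom d)).
    by apply: open_nbhs_nbhs; split; [exact: overlap_open|exists p].
  apply: filterS => _ [q [cq dq] <-] /=.
  by rewrite /h /f /g (transitionE e cq) (transitionE d cq) (transitionE e dq).
rewrite -fx; clearbody f g h x => {fx}.
transitivity ('D_(delta_mx 0 i) h x); first by rewrite (deriveEjacobian _ dh).
rewrite (near_eq_derive _ hgf) (deriveE _ (differentiable_comp df dg)).
rewrite (diff_comp df dg) /=.
rewrite -(deriveEjacobian _ df) (deriveE _ df).
by rewrite -(deriveEjacobian _ dg) (deriveE _ dg).
Qed.

Lemma tangent_eq p (v w : tangent p) c : dom c p -> tcomp v c = tcomp w c -> v = w.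
Proof.
case: v w => [v v0 vJ] [w w0 wJ] cp /= vw.
have E : v = w.
  apply/funext => d; have [dp|dp] := pselect (dom d p).
    by rewrite (vJ c d) // (wJ c d) // vw.
  by rewrite v0 ?w0.
by subst w; congr Tangent; exact: Prop_irrelevance.
Qed.

(* The tangent vector at p with components u in the chart c (0 if p is not in
   the domain of c). *)
Definition mk_comp c p (u : 'rV[R]_n) d : 'rV[R]_n :=
  if `[< dom c p /\ dom d p >] then u *m 'J (transition c d) (coord c p)
  else 0.

Fact mk_comp_out c p u d : ~ dom d p -> mk_comp c p u d = 0.
Proof. by move=> dp; rewrite /mk_comp asboolF // => -[]. Qed.

Fact mk_comp_change c p u d e : dom d p -> dom e p ->
  mk_comp c p u e = mk_comp c p u d *m 'J (transition d e) (coord d p).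
Proof.
move=> dp ep; rewrite /mk_comp; have [cp|cp] := pselect (dom c p).
  rewrite (asboolT (conj cp dp)) (asboolT (conj cp ep)).
  by rewrite -mulmxA (jacobian_transition_comp cp dp ep).
by rewrite !asboolF ?mul0mx // => -[].
Qed.

Definition mk_tangent c p u : tangent p :=
  Tangent (@mk_comp_out c p u) (@mk_comp_change c p u).

Lemma mk_tangentE c p u : dom c p -> tcomp (mk_tangent c p u) c = u.
Proof.
move=> cp; rewrite /= /mk_comp (asboolT (conj cp cp)).
by rewrite (jacobian_transition_id cp) mulmx1.
Qed.

Fact scale_comp_out p (l : R) (v : tangent p) c :
  ~ dom c p -> l *: tcomp v c = 0.
Proof. by move=> cp; rewrite comp_out ?scaler0. Qed.

Fact scale_comp_change p (l : R) (v : tangent p) c d : dom c p -> dom d p ->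
  l *: tcomp v d = (l *: tcomp v c) *m 'J (transition c d) (coord c p).
Proof. by move=> cp dp; rewrite -scalemxAl -comp_change. Qed.

Definition tangent_scale p (l : R) (v : tangent p) : tangent p :=
  Tangent (scale_comp_out l v) (scale_comp_change l v).

Definition chart_at p : chart M := projT1 (cid (dom_cover p)).

Lemma dom_chart_at p : dom (chart_at p) p.
Proof. by rewrite /chart_at; case: cid. Qed.

End Tangent.
Arguments tangent {R n} M p.

Section TangentMap.
Context {R : realType} {m n : nat} {M : manifold R m} {N : manifold R n}.

(* The tangent map T_x f, computed in some charts at x and f x; for f
   differentiable the result does not depend on the charts. *)
Definition tangent_map (f : M -> N) (x : M) (v : tangent M x) :
    tangent N (f x) :=
  let c := chart_at x in let d := chart_at (f x) in
  mk_tangent d (f x)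
    (tcomp v c *m 'J (local_expr (dom c) (coord c) (coord d \o f)) (coord c x)).

(* The pullback of forms, defined pointwise; meaningful for f differentiable. *)
Definition pullback (f : M -> N) (w : forall y : N, tangent N y -> R) :
    forall x : M, tangent M x -> R :=
  fun x v => w (f x) (tangent_map f v).

End TangentMap.

(* A 1-form has in each chart the expression \sum_i a_i dx^i with a smooth; in
   particular it is linear on each tangent space. *)
Record one_form R n (M : manifold R n) := OneForm {
  form_val :> forall p : M, tangent M p -> R;
  form_smooth : forall c : chart M, exists2 a : 'rV[R]_n -> 'rV[R]_n,
    smooth (coord c @` dom c) a &
    forall (p : M) (v : tangent M p), dom c p ->
      form_val v = \sum_i a (coord c p) 0 i * tcomp v c 0 i
}.

Section TangentBundle.
Context {R : realType} {n : nat} (M : manifold R n).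

Definition TM_carrier := {p : M & tangent M p}.
Implicit Types (xi : TM_carrier) (c d : chart M).

(* The charts of the tangent bundle are indexed by those of M: each chart (y^s) of M
   gives the associated chart (y^s, \dot y^s). *)
Definition TM_dom c : set TM_carrier := [set xi | dom c (tag xi)].

Definition TM_coord c xi : 'rV[R]_(n + n) :=
  row_mx (coord c (tag xi)) (tcomp (tagged xi) c).

Fact TM_cover xi : exists c, TM_dom c xi.
Proof. exact: dom_cover. Qed.

Fact TM_inj c xi zeta : TM_dom c xi -> TM_dom c zeta ->
  TM_coord c xi = TM_coord c zeta -> xi = zeta.
Proof.
case: xi zeta => [p v] [q w]; rewrite /TM_dom /TM_coord /= => cp cq.
move=> /eq_row_mx[/(coord_inj cp cq) pq]; subst q.
by move=> /(tangent_eq cp) ->.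
Qed.

Lemma TM_overlapE c d : TM_coord c @` (TM_dom c `&` TM_dom d) =
  lsubmx @^-1` (coord c @` (dom c `&` dom d)).
Proof.
apply/seteqP; split=> [_ [[p v] [cp dp] <-]|x [p [cp dp] px]].
  by rewrite /TM_coord /= row_mxKl; exists p.
exists (existT _ p (mk_tangent c p (rsubmx x))) => //.
by rewrite /TM_coord mk_tangentE // px hsubmxK.
Qed.

Fact TM_overlap c d : open (TM_coord c @` (TM_dom c `&` TM_dom d)).
Proof.
rewrite TM_overlapE; apply: open_comp; last exact: overlap_open.
by move=> x _; exact: continuous_lsubmx.
Qed.

Fact TM_transition c d : smooth (TM_coord c @` (TM_dom c `&` TM_dom d))
  (local_expr (TM_dom c) (TM_coord c) (TM_coord d)).
Proof.
move=> k; have oU := @TM_overlap c d.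
pose f (x : 'rV[R]_(n + n)) := row_mx (transition c d (lsubmx x))
  (rsubmx x *m 'J (transition c d) (lsubmx x)).
apply: (@Ck_eq _ _ _ _ _ f) => //.
  move=> _ [[p v] [cp dp] <-]; rewrite local_exprE //; last exact: TM_inj.
  rewrite /f /TM_coord /= row_mxKl row_mxKr transitionE //.
  by rewrite -comp_change.
have oV := overlap_open c d.
have UV x : (TM_coord c @` (TM_dom c `&` TM_dom d)) x ->
    (coord c @` (dom c `&` dom d)) (lsubmx x) by rewrite TM_overlapE.
have cl j : Ck j (TM_coord c @` (TM_dom c `&` TM_dom d))
    (lsubmx : 'rV[R]_(n + n) -> 'rV[R]_n).
  by apply: Ck_lsubmx => //; exact: Ck_id.
have cr j : Ck j (TM_coord c @` (TM_dom c `&` TM_dom d))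
    (rsubmx : 'rV[R]_(n + n) -> 'rV[R]_n).
  by apply: Ck_rsubmx => //; exact: Ck_id.
apply: Ck_row_mx => //.
  apply: (Ck_comp oU oV) => //; exact: transition_smooth.
apply: Ck_mulmx => //; apply: (Ck_comp oU oV) => //.
by apply: Ck_jacobian => //; exact: transition_smooth.
Qed.

Definition TM : manifold R (n + n) :=
  Manifold TM_cover TM_inj TM_overlap TM_transition.

End TangentBundle.

Section OpenSubmanifold.
Context {R : realType} {n : nat} (M : manifold R n) (S : set M).
Context (openS : atlas_open S).

Definition sub_carrier := {p : M | S p}.
Implicit Types (c d : chart M) (p q : sub_carrier).

Definition sub_dom c : set sub_carrier := [set p | dom c (sval p)].

Definition sub_coord c p : 'rV[R]_n := coord c (sval p).

Fact sub_cover p : exists c, sub_dom c p.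
Proof. exact: dom_cover. Qed.

Fact sub_inj c p q : sub_dom c p -> sub_dom c q ->
  sub_coord c p = sub_coord c q -> p = q.
Proof.
case: p q => [p Sp] [q Sq] /= cp cq /(coord_inj cp cq) /= pq; subst q.
by congr exist; exact: Prop_irrelevance.
Qed.

Lemma sub_overlapE c d : sub_coord c @` (sub_dom c `&` sub_dom d) =
  coord c @` (S `&` dom c) `&` coord c @` (dom c `&` dom d).
Proof.
apply/seteqP; split=> [_ [[p Sp] [cp dp] <-]|].
  by split; exists p.
move=> _ [[p [Sp cp] <-]] [q [cq dq] /(coord_inj cq cp) qp]; subst q.
by exists (exist _ p Sp).
Qed.

Fact sub_overlap c d : open (sub_coord c @` (sub_dom c `&` sub_dom d)).
Proof.
rewrite sub_overlapE; apply: openI; first exact: openS.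
exact: overlap_open.
Qed.

Fact sub_transition c d : smooth (sub_coord c @` (sub_dom c `&` sub_dom d))
  (local_expr (sub_dom c) (sub_coord c) (sub_coord d)).
Proof.
move=> k; apply: (@Ck_eq _ _ _ _ _ (transition c d)); first exact: sub_overlap.
  move=> _ [p [cp dp] <-]; rewrite local_exprE //; last exact: sub_inj.
  exact: transitionE.
apply: Ck_sub (transition_smooth c d k).
by rewrite sub_overlapE; exact: subIsetr.
Qed.

Definition open_submanifold : manifold R n :=
  Manifold sub_cover sub_inj sub_overlap sub_transition.

End OpenSubmanifold.

Section Line.
Context (R : realType).

Definition line_coord (c : unit) (t : R) : 'rV[R]_1 := const_mx t.

Fact line_cover (t : R) : exists c : unit, [set: R] t.
Proof. by exists tt. Qed.

Fact line_inj (c : unit) (s t : R) : [set: R] s -> [set: R] t ->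
  line_coord c s = line_coord c t -> s = t.
Proof. by move=> _ _ /matrixP/(_ 0 0); rewrite !mxE. Qed.

Lemma line_imageE c (A : set R) :
  line_coord c @` A = (fun x : 'rV[R]_1 => x 0 0) @^-1` A.
Proof.
apply/seteqP; split=> [_ [t At <-]|x Ax]; first by rewrite /= mxE.
by exists (x 0 0) => //; apply/rowP => i; rewrite mxE ord1.
Qed.

Lemma line_image_open c (A : set R) : open A -> open (line_coord c @` A).
Proof.
move=> oA; rewrite line_imageE; apply: open_comp => // x _.
exact: coord_continuous.
Qed.

Fact line_overlap (c d : unit) :
  open (line_coord c @` ([set: R] `&` [set: R])).
Proof. by apply: line_image_open; rewrite setIT; exact: openT. Qed.

Fact line_transition (c d : unit) :
  smooth (line_coord c @` ([set: R] `&` [set: R]))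
    (local_expr [set: R] (line_coord c) (line_coord d)).
Proof.
move=> k; apply: (@Ck_eq _ _ _ _ _ id); first exact: line_overlap.
  move=> _ [t _ <-]; rewrite local_exprE //; last exact: line_inj.
apply: Ck_id; exact: line_overlap.
Qed.

Definition line : manifold R 1 :=
  Manifold line_cover line_inj line_overlap line_transition.

Lemma line_open (A : set R) : open A -> atlas_open (A : set line).
Proof. by move=> oA c; rewrite setIT; exact: line_image_open. Qed.

Section OpenSubset.
Context (A : set R) (openA : open A).

Definition open_line : manifold R 1 := open_submanifold (line_open openA).

(* The coordinate vector d/dt and the coordinate form dt of an open subset A of
   the line. *)
Definition ddt (t : open_line) : tangent open_line t :=
  @mk_tangent _ _ open_line tt t (const_mx 1).

Definition dt (t : open_line) (v : tangent open_line t) : R := tcomp v tt 0 0.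

End OpenSubset.
End Line.

Definition canonical_lift R n (Y : manifold R n) (A : set R) (openA : open A)
    (zeta : open_line openA -> Y) (t : open_line openA) : TM Y :=
  existT _ (zeta t) (tangent_map zeta (ddt t)).

Definition TM_scale R n (Y : manifold R n) (l : R) (xi : TM Y) : TM Y :=
  existT _ (tag xi) (tangent_scale l (tagged xi)).

Section Grassmann.
Context {R : realType} {n : nat} (Y : manifold R n).

Definition nonzero : set (TM Y) :=
  [set xi | exists c, tcomp (tagged xi) c != 0].

Lemma nonzeroE (xi : TM Y) c : dom c (tag xi) ->
  nonzero xi <-> tcomp (tagged xi) c != 0.
Proof.
move=> cx; split=> [[d]|]; last by exists c.
have [dx|dx] := pselect (dom d (tag xi)); last by rewrite comp_out // eqxx.
apply: contra_neq => c0; rewrite (comp_change (tagged xi) cx dx) c0.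
exact: mul0mx.
Qed.

Lemma nonzero_open : atlas_open nonzero.
Proof.
move=> c.
rewrite (_ : _ @` _ = coord c @` dom c `&` [set x | rsubmx x != 0]).
  apply: openI; first exact: dom_image_open.
  rewrite (_ : [set x | _] = rsubmx @^-1` ~` [set 0]); last first.
    by apply/seteqP; split=> x /= /eqP.
  apply: open_comp => [x _|]; first exact: continuous_rsubmx.
  apply/closed_openC/accessible_closed_set1/hausdorff_accessible.
  exact: norm_hausdorff.
apply/seteqP; split=> [_ [xi [nz cx] <-]|_ [[xi cx <-] /=]].
  split; first by exists xi.
  by rewrite /= row_mxKr; apply/(nonzeroE cx).
by rewrite row_mxKr => nz; exists xi => //; split=> //; apply/(nonzeroE cx).
Qed.

Definition nonzeroTM : manifold R (n + n) := open_submanifold nonzero_open.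

Definition pos_equiv (xi zeta : nonzeroTM) : bool :=
  `[< exists2 l : R, 0 < l & sval xi = TM_scale l (sval zeta) >].

Lemma TM_scale1 (xi : TM Y) : TM_scale 1 xi = xi.
Proof.
case: xi => p v; congr existT; have [c cp] := dom_cover p.
by apply: (tangent_eq cp); rewrite /= scale1r.
Qed.

Lemma TM_scaleA (k l : R) (xi : TM Y) :
  TM_scale k (TM_scale l xi) = TM_scale (k * l) xi.
Proof.
case: xi => p v; congr existT; have [c cp] := dom_cover p.
by apply: (tangent_eq cp); rewrite /= scalerA.
Qed.

Lemma pos_equiv_refl : reflexive pos_equiv.
Proof. by move=> x; apply/asboolP; exists 1 => //; rewrite TM_scale1. Qed.

Lemma pos_equiv_sym : symmetric pos_equiv.
Proof.
suff h x y : pos_equiv x y -> pos_equiv y x.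
  by move=> x y; apply/idP/idP; exact: h.
move=> /asboolP[l l0 xy]; apply/asboolP; exists l^-1; first by rewrite invr_gt0.
by rewrite xy TM_scaleA mulVf ?gt_eqF// TM_scale1.
Qed.

Lemma pos_equiv_trans : transitive pos_equiv.
Proof.
move=> y x z /asboolP[k k0 xy] /asboolP[l l0 yz]; apply/asboolP.
by exists (k * l); [exact: mulr_gt0|rewrite xy yz TM_scaleA].
Qed.

Canonical pos_equiv_rel :=
  EquivRel pos_equiv pos_equiv_refl pos_equiv_sym pos_equiv_trans.

Definition G1_carrier := {eq_quot pos_equiv_rel}.

Definition vec (c : chart Y) (xi : nonzeroTM) : 'rV[R]_n :=
  tcomp (tagged (sval xi)) c.

Definition G1_chart : Type := (chart Y * 'I_n * bool)%type.
Implicit Types (x y : nonzeroTM) (g h : G1_carrier) (a b : G1_chart).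

(* The chart (c, i, b) of G^1 Y is defined on the classes of the vectors whose
   i-th component in the chart c has the sign (-1)^b; its coordinates are the
   coordinates of the base point and the ratios of the components to the absolute
   value of the i-th one, the i-th ratio (-1)^b being left out. *)
Definition sdom a : set nonzeroTM :=
  [set x | dom a.1.1 (tag (sval x)) /\ 0 < (-1) ^+ a.2 * vec a.1.1 x 0 a.1.2].

Definition scoord a x : 'rV[R]_(n + n.-1) :=
  let v := vec a.1.1 x in
  row_mx (coord a.1.1 (tag (sval x))) (col' a.1.2 (`|v 0 a.1.2|^-1 *: v)).

Definition G1_dom a : set G1_carrier := [set g | sdom a (repr g)].

Definition G1_coord a g : 'rV[R]_(n + n.-1) := scoord a (repr g).

Lemma pos_equivP x y : pos_equiv x y <->
  exists2 l : R, 0 < l & tag (sval x) = tag (sval y) /\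
    forall c, vec c x = l *: vec c y.
Proof.
split=> [/asboolP[l l0 xy]|[l l0 []]].
  by exists l => //; rewrite /vec xy.
case: x y => [[p v] nv] [[q w] nw] /= pq; subst q => vw.
apply/asboolP; exists l => //=; congr existT.
have [c cp] := dom_cover p; apply: (tangent_eq cp); exact: vw.
Qed.

Lemma sdom_pos_equiv a x y : pos_equiv x y -> sdom a x -> sdom a y.
Proof.
move=> /pos_equivP[l l0 [xy ve]] []; rewrite /sdom /= xy ve mxE.
by rewrite mulrCA pmulr_rgt0.
Qed.

Lemma scoord_pos_equiv a x y : pos_equiv x y -> scoord a x = scoord a y.
Proof.
move=> /pos_equivP[l l0 [xy ve]]; rewrite /scoord /= xy ve.
congr (row_mx _ (col' _ _)); rewrite mxE normrM gtr0_norm // scalerA invfM.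
by rewrite mulrAC mulVf ?gt_eqF// mul1r.
Qed.

Lemma repr_pos_equiv x : pos_equiv (repr (\pi_(G1_carrier) x)) x.
Proof. by apply/eqmodP; rewrite reprK. Qed.

Lemma G1_eqP g h : pos_equiv (repr g) (repr h) -> g = h.
Proof. by move=> /(@eqmodP _ pos_equiv_rel); rewrite !reprK. Qed.

Definition insert (i : 'I_n) (s : R) (w : 'rV[R]_n.-1) : 'rV[R]_n :=
  \row_j oapp (w 0) s (unlift i j).

Lemma insert_col' i (u : 'rV[R]_n) : insert i (u 0 i) (col' i u) = u.
Proof.
by apply/rowP => j; rewrite mxE; case: unliftP => [k ->|->] //=; rewrite mxE.
Qed.

Lemma col'_insert i s (w : 'rV[R]_n.-1) : col' i (insert i s w) = w.
Proof. by apply/rowP => j; rewrite !mxE liftK. Qed.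

Lemma insert_id i s (w : 'rV[R]_n.-1) : insert i s w 0 i = s.
Proof. by rewrite mxE unlift_none. Qed.

Lemma sdom_norm a x : sdom a x ->
  `|vec a.1.1 x 0 a.1.2| = (-1) ^+ a.2 * vec a.1.1 x 0 a.1.2.
Proof.
move=> [_ h]; rewrite -(gtr0_norm h) normrM normrX normrN1 expr1n mul1r.
by [].
Qed.

Lemma sdom_insert a x : sdom a x ->
  insert a.1.2 ((-1) ^+ a.2) (rsubmx (scoord a x)) =
  `|vec a.1.1 x 0 a.1.2|^-1 *: vec a.1.1 x.
Proof.
move=> ax; have [_ h] := ax.
rewrite row_mxKr -[RHS](insert_col' a.1.2); congr (insert _ _ _).
rewrite mxE (sdom_norm ax) invfM -mulrA mulVf.
  by rewrite mulr1 invr_sign.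
by apply: contraTneq h => ->; rewrite mulr0 ltxx.
Qed.

Lemma sdom_norm_gt0 a x : sdom a x -> 0 < `|vec a.1.1 x 0 a.1.2|.
Proof. by move=> ax; rewrite sdom_norm //; case: ax. Qed.

Lemma scoord_inj a x y : sdom a x -> sdom a y -> scoord a x = scoord a y ->
  pos_equiv x y.
Proof.
move=> ax ay xy; have [cx _] := ax; have [cy _] := ay.
have pq : tag (sval x) = tag (sval y).
  apply: (coord_inj cx cy).
  by have := congr1 lsubmx xy; rewrite !row_mxKl.
have := sdom_insert ax; rewrite xy (sdom_insert ay) => vE.
have nx := sdom_norm_gt0 ax; have ny := sdom_norm_gt0 ay.
apply/pos_equivP.
exists (`|vec a.1.1 x 0 a.1.2| * `|vec a.1.1 y 0 a.1.2|^-1).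
  by rewrite mulr_gt0 ?invr_gt0.
split=> // d; have [dx|dx] := pselect (dom d (tag (sval x))); last first.
  have dy : ~ dom d (tag (sval y)) by rewrite -pq.
  by rewrite /vec (comp_out _ dx) (comp_out _ dy) scaler0.
have dy : dom d (tag (sval y)) by rewrite -pq.
have := comp_change (tagged (sval x)) cx dx.
have := comp_change (tagged (sval y)) cy dy.
rewrite -!/(vec _ _) -pq => -> ->; rewrite scalemxAl; congr (_ *m _).
by rewrite -scalerA vE scalerA divff ?scale1r // gt_eqF.
Qed.

Fact G1_cover g : exists a, G1_dom a g.
Proof.
have [c cp] := dom_cover (tag (sval (repr g))).
have /(nonzeroE cp) : nonzero (sval (repr g)) by case: (repr g).
case/rV0Pn => i vi; exists (c, i, vec c (repr g) 0 i < 0) => /=.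
by split=> //=; rewrite -normrEsign normr_gt0.
Qed.

Fact G1_inj a g h : G1_dom a g -> G1_dom a h ->
  G1_coord a g = G1_coord a h -> g = h.
Proof. by move=> ag ah gh; apply: G1_eqP; exact: scoord_inj gh. Qed.

(* The components in the chart of b of the representative, normalized in the
   chart a, of the class with coordinates z in the chart a. *)
Definition G1_vec a b (z : 'rV[R]_(n + n.-1)) : 'rV[R]_n :=
  insert a.1.2 ((-1) ^+ a.2) (rsubmx z)
    *m 'J (transition a.1.1 b.1.1) (lsubmx z).

Lemma G1_vecE a b x : sdom a x -> dom b.1.1 (tag (sval x)) ->
  G1_vec a b (scoord a x) = `|vec a.1.1 x 0 a.1.2|^-1 *: vec b.1.1 x.
Proof.
move=> ax bx; have [cx _] := ax.
rewrite /G1_vec sdom_insert // row_mxKl -scalemxAl.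
by rewrite /vec -(comp_change _ cx bx).
Qed.

Let base_overlap a b : set 'rV[R]_(n + n.-1) :=
  lsubmx @^-1` (coord a.1.1 @` (dom a.1.1 `&` dom b.1.1)).

Lemma base_overlap_open a b : open (base_overlap a b).
Proof.
apply: open_comp; last exact: overlap_open.
by move=> x _; exact: continuous_lsubmx.
Qed.

Lemma G1_overlapE a b : G1_coord a @` (G1_dom a `&` G1_dom b) =
  base_overlap a b `&` [set z | 0 < (-1) ^+ b.2 * G1_vec a b z 0 b.1.2].
Proof.
apply/seteqP; split=> [_ [g [ag bg] <-]|z [[p [ap bp] pz] qz]].
  have [ca _] := ag; have [cb hb] := bg.
  split; first by rewrite /base_overlap /= row_mxKl; exists (tag (sval (repr g))).
  rewrite /= G1_vecE // mxE mulrCA pmulr_rgt0 //.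
  by rewrite invr_gt0; exact: sdom_norm_gt0.
pose v := mk_tangent a.1.1 p (insert a.1.2 ((-1) ^+ a.2) (rsubmx z)).
pose xi : TM Y := existT _ p v.
have va : tcomp v a.1.1 = insert a.1.2 ((-1) ^+ a.2) (rsubmx z).
  exact: mk_tangentE.
have nz : nonzero xi.
  exists a.1.1; rewrite va; apply/rV0Pn; exists a.1.2.
  by rewrite insert_id signr_eq0.
pose x : nonzeroTM := exist _ xi nz.
have ax : sdom a x.
  by split=> //; rewrite [vec _ _]va insert_id -expr2 sqrr_sign.
have xz : scoord a x = z.
  rewrite /scoord [vec _ _]va insert_id normrX normrN1 expr1n invr1 scale1r.
  by rewrite col'_insert pz hsubmxK.
have bx : sdom b x.
  split=> //; move: qz; rewrite /= -xz G1_vecE // mxE mulrCA pmulr_rgt0 //.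
  by rewrite invr_gt0; exact: sdom_norm_gt0.
have rx := repr_pos_equiv x; have xr := rx; rewrite pos_equiv_sym in xr.
exists (\pi_(G1_carrier) x); last by rewrite -xz; exact: scoord_pos_equiv.
by split; [exact: sdom_pos_equiv ax|exact: sdom_pos_equiv bx].
Qed.

Lemma Ck_G1_vec k a b : Ck k (base_overlap a b) (G1_vec a b).
Proof.
have oU := @base_overlap_open a b.
apply: Ck_mulmx => //.
  apply: Ck_mx => // i j.
  rewrite (_ : (fun _ => _) = fun z : 'rV[R]_(n + n.-1) =>
    oapp (fun l => z 0 (rshift n l)) ((-1) ^+ a.2) (unlift a.1.2 j)).
    case: (unlift _ _) => [l|] /=; last exact: Ck_cst.
    by apply: Ck_entry => //; exact: Ck_id.
  by apply/funext => z; rewrite mxE; case: (unlift _ _) => //= l; rewrite mxE.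
have oV := overlap_open a.1.1 b.1.1.
apply: (Ck_comp oU oV) => //; first by apply: Ck_lsubmx => //; exact: Ck_id.
by apply: Ck_jacobian => //; exact: transition_smooth.
Qed.

Lemma Ck_G1_sign k a b : Ck k (base_overlap a b)
  (fun z => (-1) ^+ b.2 * G1_vec a b z 0 b.1.2).
Proof.
have oU := @base_overlap_open a b.
apply: (@Ck_mul _ _ _ _ (cst ((-1) ^+ b.2))) => //; first exact: Ck_cst.
by apply: Ck_entry => //; exact: Ck_G1_vec.
Qed.

Fact G1_overlap a b : open (G1_coord a @` (G1_dom a `&` G1_dom b)).
Proof.
rewrite G1_overlapE openE => z [Uz qz]; apply: filterI.
  by apply: open_nbhs_nbhs; split=> //; exact: base_overlap_open.
exact: (cvgr_gt _ (@Ck_G1_sign 0 a b z Uz) _ qz).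
Qed.

Fact G1_transition a b : smooth (G1_coord a @` (G1_dom a `&` G1_dom b))
  (local_expr (G1_dom a) (G1_coord a) (G1_coord b)).
Proof.
move=> k; have oW := @G1_overlap a b.
pose q z := (-1) ^+ b.2 * G1_vec a b z 0 b.1.2.
pose f z := row_mx (transition a.1.1 b.1.1 (lsubmx z))
  (col' b.1.2 ((q z)^-1 *: G1_vec a b z)).
apply: (@Ck_eq _ _ _ _ _ f) => //.
  move=> _ [g [ag bg] <-]; rewrite local_exprE //; last exact: G1_inj.
  have [ca _] := ag; have [cb hb] := bg.
  rewrite /f {1}/G1_coord row_mxKl (transitionE _ ca); congr row_mx.
  rewrite /q [G1_coord a g]/(scoord _ _) G1_vecE // mxE.
  have na := sdom_norm_gt0 ag.
  rewrite mulrCA -(sdom_norm bg) scalerA invfM invrK mulrAC divff ?gt_eqF//.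
  by rewrite mul1r.
have WU : G1_coord a @` (G1_dom a `&` G1_dom b) `<=` base_overlap a b.
  by rewrite G1_overlapE; exact: subIsetl.
have oV := overlap_open a.1.1 b.1.1.
apply: Ck_row_mx => //.
  apply: (Ck_comp oW oV); first exact: WU.
    by apply: Ck_lsubmx => //; exact: Ck_id.
  exact: transition_smooth.
apply: Ck_mx => // i j.
rewrite (_ : (fun _ => _) =
  (fun z => (q z)^-1) * (fun z => G1_vec a b z 0 (lift b.1.2 j))).
  apply: Ck_mul => //; last first.
    by apply: Ck_entry => //; apply: Ck_sub WU _; exact: Ck_G1_vec.
  apply: Ck_inv => //; last by apply: Ck_sub WU _; exact: Ck_G1_sign.
  by rewrite G1_overlapE => z [_ /= qz]; rewrite gt_eqF.
by apply/funext => z; rewrite (ord1 i) [LHS]mxE [LHS]mxE.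
Qed.

Definition G1 : manifold R (n + n.-1) :=
  Manifold G1_cover G1_inj G1_overlap G1_transition.

(* The quotient projection of the nonzero vectors on G^1 Y. *)
Definition kappa (x : nonzeroTM) : G1 := \pi_(G1_carrier) x.

End Grassmann.

Section HilbertForm.
Context {R : realType} {n : nat} {Y : manifold R n}.

(* eta = (dF / d\dot y^nu) dy^nu in all the associated charts. *)
Definition hilbert_form_of (F : TM Y -> R) (eta : one_form (TM Y)) : Prop :=
  forall (c : chart (TM Y)) (xi : TM Y) (w : tangent (TM Y) xi), dom c xi ->
    eta xi w = \sum_(nu < n)
      'D_(row_mx 0 (delta_mx 0 nu)) (local_expr (dom c) (coord c) F) (coord c xi)
      * tcomp w c 0 (lshift n nu).

Definition homogeneous (F : TM Y -> R) : Prop :=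
  forall (xi : TM Y) (l : R), 0 < l -> F (TM_scale l xi) = l * F xi.

Definition projectable (eta : one_form (TM Y)) : Prop :=
  exists etat : one_form (G1 Y),
    pullback (@kappa R n Y) etat =
    pullback (sval : nonzeroTM Y -> TM Y) eta.

End HilbertForm.

(* Main.v *)
(* The form eta is the fibre derivative of F composed with the projection of TY:
   eta(w) = d/dh F(xi + h Tpi(w)) at h = 0, for w tangent to TY at xi, which does
   not involve charts. If F is positively homogeneous, its fibre derivative is the
   same at xi and at l xi for l > 0; so it makes sense on the classes of G^1 Y, and
   as pi factors through kappa, eta is the pullback of the form obtained there.
   Along the lift of zeta, Tpi maps the image of d/dt to the velocity of zeta, so
   that eta is the derivative of F(zeta' + h zeta') = (1 + h) F(zeta'), that is
   F(zeta'). *)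
Require Import Defs.
From HB Require Import structures.
From mathcomp Require Import all_boot all_order all_algebra generic_quotient.
From mathcomp Require Import all_classical all_reals all_analysis.
(* Gives [coord] back its meaning, after the one of vector.v. *)
Import Defs.
Import Order.TTheory GRing.Theory Num.Theory.
Import numFieldNormedType.Exports.
Local Open Scope classical_set_scope.
Local Open Scope ring_scope.

Set Implicit Arguments.
Unset Strict Implicit.
Unset Printing Implicit Defensive.

(** * Jacobian matrices acting on row vectors *)

Section Jacobian.
Context {R : realType}.

Lemma mulmx_rV_inj m n (A B : 'M[R]_(m, n)) :
  (forall v : 'rV_m, v *m A = v *m B) -> A = B.
Proof. by move=> AB; apply/row_matrixP => i; rewrite !rowE. Qed.

Lemma mulmx_jacobian m n (f : 'rV[R]_m -> 'rV[R]_n) x v :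
  differentiable f x -> v *m 'J f x = 'd f x v.
Proof. by move=> df; rewrite -deriveEjacobian // deriveE. Qed.

Lemma jacobian_comp m n p (f : 'rV[R]_m -> 'rV[R]_n) (g : 'rV[R]_n -> 'rV[R]_p)
    x : differentiable f x -> differentiable g (f x) ->
  'J (g \o f) x = 'J f x *m 'J g (f x).
Proof.
move=> df dg; apply/row_matrixP => i; rewrite !rowE mulmxA.
rewrite (mulmx_jacobian _ (differentiable_comp df dg)) (mulmx_jacobian _ df).
by rewrite (mulmx_jacobian _ dg) diff_comp.
Qed.

Lemma near_eq_jacobian m n (f g : 'rV[R]_m -> 'rV[R]_n) x :
  (\near x, f x = g x) -> differentiable f x -> 'J f x = 'J g x.
Proof.
move=> fg df; have dg := near_eq_differentiable fg df.
apply: mulmx_rV_inj => v.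
apply: etrans (esym (deriveEjacobian v df)) _.
apply: etrans (near_eq_derive _ fg) _; exact: deriveEjacobian.
Qed.

Lemma mulmx_jacobian_lin m n (f : {linear 'rV[R]_m -> 'rV[R]_n}) x v :
  continuous f -> v *m 'J f x = f v.
Proof.
by move=> cf; rewrite mulmx_jacobian ?diff_lin //; exact: linear_differentiable.
Qed.

End Jacobian.

(** * Tangent maps in charts and the chain rule *)

Section DiffIn.
Context {R : realType}.

(* The map f is differentiable at x, as seen in the charts c and d. The third
   clause, that f maps a neighbourhood of x into the domain of d, is what makes
   this independent of the charts: coord d \o f has junk values off it. *)
Definition diff_in m n (M : manifold R m) (N : manifold R n) (f : M -> N)
    (c : chart M) (d : chart N) (x : M) : Prop :=
  [/\ dom c x, dom d (f x),
    \forall y \near coord c x, exists q, [/\ dom c q, dom d (f q) & coord c q = y]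
  & differentiable (local_expr (dom c) (coord c) (coord d \o f)) (coord c x)].

Lemma diff_in_id n (M : manifold R n) (c d : chart M) x :
  dom c x -> dom d x -> diff_in id c d x.
Proof.
move=> cx dx; split=> //; last exact: transition_differentiable.
have : nbhs (coord c x) (coord c @` (dom c `&` dom d)).
  by apply: open_nbhs_nbhs; split; [exact: overlap_open|exists x].
by apply: filterS => y [q [cq dq] <-]; exists q.
Qed.

Section Comp.
Context m n p (M : manifold R m) (N : manifold R n) (P : manifold R p).
Context (f : M -> N) (g : N -> P) (c : chart M) (d : chart N) (e : chart P).
Context (x : M) (df : diff_in f c d x) (dg : diff_in g d e (f x)).

Let lf := local_expr (dom c) (coord c) (coord d \o f).
Let lg := local_expr (dom d) (coord d) (coord e \o g).
Let lgf := local_expr (dom c) (coord c) (coord e \o (g \o f)).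

Let lfE q : dom c q -> lf (coord c q) = coord d (f q).
Proof. by move=> cq; rewrite /lf local_exprE //; exact: coord_inj. Qed.

(** Only near the point: where [f q] leaves the domain of [d], the outer expression [lg] would be
    applied to a junk value. *)
Let lgfE : \forall y \near coord c x, (lg \o lf) y = lgf y.
Proof.
have [_ _ nf _] := df; apply: filterS nf => _ [q [cq dq <-]].
rewrite /= lfE // /lg /lgf !local_exprE //; exact: coord_inj.
Qed.

Let dlgf : differentiable (lg \o lf) (coord c x).
Proof.
have [cx _ _ df1] := df; have [_ _ _ dg1] := dg.
by apply: differentiable_comp => //; rewrite lfE.
Qed.

Lemma diff_in_comp : diff_in (g \o f) c e x.
Proof.
have [cx dx nf df1] := df; have [_ ex ng dg1] := dg.
split=> //; last exact: near_eq_differentiable lgfE dlgf.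
have lf_cont : lf y @[y --> coord c x] --> coord d (f x).
  by rewrite -(lfE cx); exact: differentiable_continuous.
have := lf_cont _ ng; rewrite near_simpl => ng'.
near=> y.
have [q [cq dq qy]] : exists q, [/\ dom c q, dom d (f q) & coord c q = y].
  by near: y.
exists q; split=> //=.
have : exists r, [/\ dom d r, dom e (g r) & coord d r = lf y] by near: y.
(* Both [r] and [f q] have the coordinates [lf y] in [d], so they coincide, which puts [g (f q)] in
   the domain of [e]. *)
move=> [r [dr er]]; rewrite -qy lfE // => /(coord_inj dr dq) <-; exact: er.
Unshelve. all: by end_near. Qed.

Lemma jacobian_diff_in_comp : 'J lgf (coord c x) =
  'J lf (coord c x) *m 'J lg (coord d (f x)).
Proof.
have [cx _ _ df1] := df; have [_ _ _ dg1] := dg.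
rewrite -(near_eq_jacobian lgfE dlgf) -(lfE cx).
by rewrite jacobian_comp // lfE.
Qed.

End Comp.

(** Frees [tangent_map] from its chosen charts. The expression of [f] in those charts is factored
    through [c] and [d]; the transition at the source turns the components of [v] into those in [c],
    and the two transitions at the target cancel. *)
Lemma tangent_mapE m n (M : manifold R m) (N : manifold R n) (f : M -> N) c d x
    (v : tangent M x) : diff_in f c d x ->
  tcomp (tangent_map f v) d =
  tcomp v c *m 'J (local_expr (dom c) (coord c) (coord d \o f)) (coord c x).
Proof.
move=> df; have [cx dx _ _] := df.
rewrite /tangent_map; set c' := chart_at x; set d' := chart_at (f x).
have cx' : dom c' x by exact: dom_chart_at.
have dx' : dom d' (f x) by exact: dom_chart_at.
rewrite (comp_change _ dx' dx) mk_tangentE //.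
have i1 := diff_in_id cx' cx; have i2 := diff_in_id dx dx'.
have fi := diff_in_comp i1 df.
have /= -> := jacobian_diff_in_comp fi i2.
have /= -> := jacobian_diff_in_comp i1 df.
rewrite !mulmxA -(comp_change v cx' cx) -!mulmxA.
have := jacobian_transition_comp dx dx' dx.
by rewrite (jacobian_transition_id dx) => <-; rewrite mulmx1.
Qed.

Lemma tangent_map_comp m n p (M : manifold R m) (N : manifold R n)
    (P : manifold R p) (f : M -> N) (g : N -> P) c d e x (v : tangent M x) :
  diff_in f c d x -> diff_in g d e (f x) ->
  tangent_map g (tangent_map f v) = tangent_map (g \o f) v.
Proof.
move=> df dg; have [_ ex _ _] := dg.
apply: (tangent_eq ex); rewrite (tangent_mapE _ dg) (tangent_mapE _ df).
rewrite (tangent_mapE _ (diff_in_comp df dg)).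
by rewrite (jacobian_diff_in_comp df dg) mulmxA.
Qed.

Lemma tangent_mapZ m n (M : manifold R m) (N : manifold R n) (f : M -> N) x l
    (v : tangent M x) :
  tangent_map f (tangent_scale l v) = tangent_scale l (tangent_map f v).
Proof.
have dx := dom_chart_at (f x); apply: (tangent_eq dx).
transitivity (l *: tcomp (tangent_map f v) (chart_at (f x))) => //.
by rewrite /tangent_map !mk_tangentE // scalemxAl.
Qed.

Lemma atlas_open_dom n (M : manifold R n) (c : chart M) : atlas_open (dom c).
Proof. by move=> d; rewrite setIC; exact: overlap_open. Qed.

(** Continuity supplies the neighbourhood clause of [diff_in]: the preimage of the domain of [d] is
    open. *)
Lemma differentiable_map_diff_in m n (M : manifold R m) (N : manifold R n)
    (f : M -> N) c d x :
  differentiable_map f -> dom c x -> dom d (f x) -> diff_in f c d x.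
Proof.
move=> [cf df] cx dx; split=> //; last exact: df.
have /continuousP/(_ (dom d) (@atlas_open_dom _ _ d)) od := cf.
have : nbhs (coord c x) (coord c @` ((f @^-1` dom d) `&` dom c)).
  by apply: open_nbhs_nbhs; split; [exact: od|exists x].
by apply: filterS => y [q [dq cq] <-]; exists q.
Qed.

End DiffIn.

(** * The derivative of a function along the fibres of TY *)

Section FiberDerivative.
Context {R : realType} {n : nat} {Y : manifold R n}.
Implicit Types (p : Y) (F : TM Y -> R) (xi : TM Y) (c : chart Y).

Fact line_comp_out p (v w : tangent Y p) (h : R) c :
  ~ dom c p -> tcomp v c + h *: tcomp w c = 0.
Proof. by move=> cp; rewrite !comp_out // scaler0 addr0. Qed.

Fact line_comp_change p (v w : tangent Y p) (h : R) c d : dom c p -> dom d p ->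
  tcomp v d + h *: tcomp w d =
  (tcomp v c + h *: tcomp w c) *m 'J (transition c d) (coord c p).
Proof.
by move=> cp dp; rewrite mulmxDl -scalemxAl -!comp_change.
Qed.

Definition tangent_line p (v w : tangent Y p) (h : R) : tangent Y p :=
  Tangent (line_comp_out v w h) (line_comp_change v w h).

Definition fiber_derive F xi (w : tangent Y (tag xi)) : R :=
  'D_1 (fun h : R => F (existT _ (tag xi) (tangent_line (tagged xi) w h))) 0.

Section Chart.
Context F xi (w : tangent Y (tag xi)) (c : chart (TM Y)) (cx : dom c xi).

Let phi (h : R) := F (existT _ (tag xi) (tangent_line (tagged xi) w h)).
Let f := local_expr (dom c) (coord c) F.
Let dir : 'rV[R]_(n + n) := row_mx 0 (@tcomp _ _ Y _ w c).

(** In an associated chart the line through [xi] in the direction [w] is affine, with direction (0,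
    w). The difference quotients are thus equal as functions, which transfers derivability as well
    as the value of the derivative. *)
Let quotient_eq :
  (fun h => h^-1 *: ((phi \o shift 0) (h *: 1) - phi 0)) =
  (fun h => h^-1 *: ((f \o shift (coord c xi)) (h *: dir) - f (coord c xi))).
Proof.
have E h : f (h *: dir + coord c xi) = phi h.
  rewrite /phi -(@local_exprE _ _ _ (dom c) (coord c) F) //; last exact: coord_inj.
  congr local_expr; rewrite /= /TM_coord /=.
  by rewrite scale_row_mx add_row_mx scaler0 add0r addrC.
have E0 : f (coord c xi) = phi 0 by rewrite -E scale0r add0r.
by apply/funext => h; rewrite /shift /= E E0 addr0 [h *: 1]mulr1.
Qed.

Lemma fiber_deriveE : fiber_derive F w = 'D_dir f (coord c xi).
Proof. by rewrite /fiber_derive /derive quotient_eq. Qed.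

Lemma fiber_derivable : differentiable f (coord c xi) -> derivable phi 0 1.
Proof.
by move=> /(@diff_derivable _ _ _ _ _ dir); rewrite /derivable quotient_eq.
Qed.

End Chart.

Lemma smooth_fun_differentiable F xi (c : chart (TM Y)) : smooth_fun F ->
  dom c xi -> differentiable (local_expr (dom c) (coord c) F) (coord c xi).
Proof. by move=> sF cx; have [h _] := sF c 1%N; apply: h; exists xi. Qed.

(** Linearity of the differential, applied to the decomposition of (0, u) along the vertical
    coordinate vectors. *)
Lemma fiber_derive_sum F xi (w : tangent Y (tag xi)) (c : chart (TM Y)) :
  smooth_fun F -> dom c xi ->
  fiber_derive F w = \sum_(nu < n)
    'D_(row_mx 0 (delta_mx 0 nu)) (local_expr (dom c) (coord c) F) (coord c xi)
    * @tcomp _ _ Y _ w c 0 nu.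
Proof.
move=> sF cx; have df := smooth_fun_differentiable sF cx.
rewrite (fiber_deriveE F w cx) (deriveE _ df).
set u := tcomp w c.
have -> : row_mx 0 u =
    \sum_nu u 0 nu *: row_mx 0 (delta_mx 0 nu) :> 'rV[R]_(n + n).
  apply/rowP => j; rewrite summxE mxE; case: split_ordP => k -> /=.
    by rewrite mxE big1 // => i _; rewrite mxE row_mxEl mxE mulr0.
  rewrite (bigD1 k) //= big1 => [|i ik].
    by rewrite mxE row_mxEr mxE !eqxx mulr1 addr0.
  by rewrite mxE row_mxEr mxE eqxx eq_sym (negbTE ik) mulr0.
rewrite linear_sum; apply: eq_bigr => nu _.
by rewrite linearZ /= (deriveE _ df) mulrC.
Qed.

Lemma fiber_derive_scaler F xi (w : tangent Y (tag xi)) (l : R) :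
  smooth_fun F -> fiber_derive F (tangent_scale l w) = l * fiber_derive F w.
Proof.
move=> sF; have [c cx] := dom_cover xi.
rewrite !(fiber_derive_sum _ sF cx) mulr_sumr; apply: eq_bigr => nu _.
by rewrite mxE mulrCA.
Qed.

(** Euler's relation. Homogeneity applies to the factor 1 + h l, which is sure to be positive only
    for small h; agreement near 0 is enough for the derivative. *)
Lemma fiber_derive_radial F xi (l : R) : homogeneous F ->
  fiber_derive F (tangent_scale l (tagged xi)) = F xi * l.
Proof.
move=> hF.
have E : \forall h \near (0 : R),
    F (existT _ (tag xi)
        (tangent_line (tagged xi) (tangent_scale l (tagged xi)) h)) =
    (cst (F xi) + (l * F xi) *: id) h.
  have : \forall h \near (0 : R), 0 < 1 + h * l.
    have : (1 + h * l) @[h --> (0 : R)] --> 1 + 0 * l.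
      by apply: cvgD; [exact: cvg_cst|];
        apply: cvgM; [exact: cvg_id|exact: cvg_cst].
    by rewrite mul0r addr0 => /cvgr_gt/(_ 0 ltr01).
  apply: filterS => h h0.
  rewrite (_ : existT _ _ _ = TM_scale (1 + h * l) xi).
    by rewrite hF // !fctE /= mulrDl mul1r [_ *: h]mulrC mulrA.
  case: xi {h0} => p v; congr existT.
  apply: (tangent_eq (dom_chart_at p)).
  by rewrite /= scalerDl scale1r scalerA.
rewrite /fiber_derive (near_eq_derive _ E).
rewrite deriveD ?deriveZ ?derive_cst ?derive_id //.
by rewrite add0r [_ *: 1]mulr1 mulrC.
Qed.

(** Since F(l zeta + h l w) = l F(zeta + h w), the derivative at l zeta along l w is l times the
    derivative at zeta along w; linearity in the direction then lets l cancel. The directions have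
    different types, hence the comparison by components. *)
Lemma fiber_derive_homogeneous F xi zeta (w : tangent Y (tag xi))
    (w' : tangent Y (tag zeta)) (l : R) : smooth_fun F -> homogeneous F -> 0 < l ->
  xi = TM_scale l zeta -> (forall c, tcomp w c = tcomp w' c) ->
  fiber_derive F w = fiber_derive F w'.
Proof.
move=> sF hF l0 xz; subst xi => ww.
have {ww} -> : w = w'.
  by apply: (tangent_eq (dom_chart_at (tag zeta))); exact: ww.
have [c cz] := @dom_cover _ _ (TM Y) zeta.
apply: (@mulfI _ l); first by rewrite gt_eqF.
rewrite -fiber_derive_scaler //.
have dphi := @fiber_derivable F zeta w' c cz (smooth_fun_differentiable sF cz).
apply: etrans (deriveZ l dphi); congr (@derive R R^o R^o _ 0 1).
apply/funext => h.
rewrite -[RHS]/(l * F _) -hF //; congr F; congr existT.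
apply: (tangent_eq (dom_chart_at (tag zeta))).
by rewrite /= scalerDr !scalerA [h * l]mulrC.
Qed.

End FiberDerivative.

(** * Maps given in charts by an explicit formula *)

Section LocalModel.
Context {R : realType}.

(** Near the point, the choice-based [local_expr] coincides with the explicit [g], so
    differentiability and Jacobian can be read off from [g]. *)
Lemma diff_in_model m n (M : manifold R m) (N : manifold R n) (f : M -> N) c d x
    (U : set 'rV[R]_m) (g : 'rV[R]_m -> 'rV[R]_n) :
  open U -> U (coord c x) -> dom c x -> dom d (f x) ->
  (forall y, U y -> exists q, [/\ dom c q, dom d (f q) & coord c q = y]) ->
  (forall q, dom c q -> dom d (f q) -> coord d (f q) = g (coord c q)) ->
  differentiable g (coord c x) ->
  diff_in f c d x /\
  'J (local_expr (dom c) (coord c) (coord d \o f)) (coord c x) =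
  'J g (coord c x).
Proof.
move=> oU Ux cx dx Uq fg dg.
have nU : nbhs (coord c x) U by exact: open_nbhs_nbhs.
have E : \forall y \near coord c x,
    g y = local_expr (dom c) (coord c) (coord d \o f) y.
  apply: filterS nU => y /Uq[q [cq dq <-]].
  by rewrite local_exprE //= ?fg //; exact: coord_inj.
split; last by rewrite (near_eq_jacobian E dg).
by split=> //; [exact: filterS nU|exact: near_eq_differentiable E dg].
Qed.

Section Projection.
Context n k (M : manifold R (n + k)) (N : manifold R n) (f : M -> N).
Context (c : chart M) (d : chart N).
Hypothesis fd : forall q, dom c q -> dom d (f q).
Hypothesis fE : forall q, dom c q -> coord d (f q) = lsubmx (coord c q).

Let lsubmx_cont : continuous (lsubmx : 'rV[R]_(n + k) -> 'rV[R]_n).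
Proof. by move=> ?; exact: continuous_lsubmx. Qed.

Let model x : dom c x -> diff_in f c d x /\
  'J (local_expr (dom c) (coord c) (coord d \o f)) (coord c x) =
  'J lsubmx (coord c x).
Proof.
move=> cx; have oU : open (coord c @` dom c) by exact: dom_image_open.
have := @diff_in_model _ _ M N f c d x (coord c @` dom c) lsubmx oU.
apply.
- by exists x.
- by [].
- exact: fd.
- by move=> y [q cq qy]; exists q; split=> //; exact: fd.
- by move=> q cq _; exact: fE.
- exact: linear_differentiable.
Qed.

Lemma diff_in_lsubmx x : dom c x -> diff_in f c d x.
Proof. by move=> cx; case: (model cx). Qed.

(** Serves for the projections of both TY and G^1 Y to Y: each reads as the first n coordinates, a
    linear map, equal to its own differential. *)
Lemma tangent_map_lsubmx x (v : tangent M x) : dom c x ->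
  tcomp (tangent_map f v) d = lsubmx (tcomp v c).
Proof.
move=> cx; rewrite (tangent_mapE _ (diff_in_lsubmx cx)) (model cx).2.
exact: mulmx_jacobian_lin.
Qed.

End Projection.

(** The forms on TY and on G^1 Y are horizontal: their coefficients along the fibre coordinates
    vanish. *)
Lemma sum_row_mx0 n k (a : 'rV[R]_n) (u : 'rV[R]_(n + k)) :
  \sum_i row_mx a 0 0 i * u 0 i = \sum_nu a 0 nu * lsubmx u 0 nu.
Proof.
rewrite big_split_ord /= [X in _ + X]big1 ?addr0 => [|i _].
  by apply: eq_bigr => i _; rewrite row_mxEl mxE.
by rewrite row_mxEr mxE mul0r.
Qed.

End LocalModel.

(** * The form on TY and its pullback along lifted curves *)

Section Hilbert.
Context {R : realType} {n : nat} {Y : manifold R n}.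
Implicit Types (F : TM Y -> R) (c : chart (TM Y)).

Definition TM_proj (xi : TM Y) : Y := tag xi.

Lemma diff_in_TM_proj c (xi : TM Y) : dom c xi ->
  @diff_in R _ _ (TM Y) Y TM_proj c c xi.
Proof. by apply: diff_in_lsubmx => // q cq; rewrite /= row_mxKl. Qed.

Lemma tcomp_TM_proj c xi (w : tangent (TM Y) xi) : dom c xi ->
  @tcomp _ _ Y _ (tangent_map TM_proj w) c = lsubmx (tcomp w c).
Proof. by apply: tangent_map_lsubmx => // q cq; rewrite /= row_mxKl. Qed.

Definition fiber_partials F c (z : 'rV[R]_(n + n)) : 'rV[R]_n :=
  \row_nu 'D_(row_mx 0 (delta_mx 0 nu)) (local_expr (dom c) (coord c) F) z.

Lemma smooth_fiber_partials F c : smooth_fun F ->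
  smooth (coord c @` dom c) (fiber_partials F c).
Proof.
move=> sF k; have oU : open (coord c @` dom c) by exact: dom_image_open.
apply: Ck_mx => // i j; apply: (Ck_eq oU _ ((sF c k.+1).2 _)) => z _.
by rewrite mxE.
Qed.

Lemma fiber_derive_partials F c xi (w : tangent Y (tag xi)) :
  smooth_fun F -> dom c xi -> fiber_derive F w =
    \sum_nu fiber_partials F c (coord c xi) 0 nu * @tcomp _ _ Y _ w c 0 nu.
Proof.
move=> sF cx; rewrite (fiber_derive_sum _ sF cx).
by apply: eq_bigr => nu _; rewrite mxE.
Qed.

Definition hilbert_val F (xi : TM Y) (w : tangent (TM Y) xi) : R :=
  fiber_derive F (tangent_map TM_proj w).

Lemma hilbert_val_partials F c xi (w : tangent (TM Y) xi) :
  smooth_fun F -> dom c xi -> hilbert_val F w =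
    \sum_nu fiber_partials F c (coord c xi) 0 nu * lsubmx (tcomp w c) 0 nu.
Proof.
move=> sF cx; rewrite /hilbert_val (fiber_derive_partials _ sF cx).
by rewrite tcomp_TM_proj.
Qed.

Fact hilbert_val_smooth F : smooth_fun F ->
  forall c, exists2 a : 'rV[R]_(n + n) -> 'rV[R]_(n + n),
    smooth (coord c @` dom c) a &
    forall (xi : TM Y) (w : tangent (TM Y) xi), dom c xi ->
      hilbert_val F w = \sum_i a (coord c xi) 0 i * tcomp w c 0 i.
Proof.
move=> sF c; exists (fun z => row_mx (fiber_partials F c z) 0) => [k|xi w cx].
  have oU : open (coord c @` dom c) by exact: dom_image_open.
  by apply: Ck_row_mx => //; [exact: smooth_fiber_partials|exact: Ck_cst].
by rewrite sum_row_mx0; exact: hilbert_val_partials.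
Qed.

(** Trades the condition on all chart expressions for equality with one chart-free function;
    existence and uniqueness of the form both come from this. *)
Lemma hilbert_form_ofP F (eta : one_form (TM Y)) : smooth_fun F ->
  hilbert_form_of F eta <->
  forall (xi : TM Y) (w : tangent (TM Y) xi), eta xi w = hilbert_val F w.
Proof.
move=> sF.
have E c xi (w : tangent (TM Y) xi) : dom c xi -> hilbert_val F w =
    \sum_(nu < n)
      'D_(row_mx 0 (delta_mx 0 nu)) (local_expr (dom c) (coord c) F) (coord c xi)
      * tcomp w c 0 (lshift n nu).
  move=> cx; rewrite (hilbert_val_partials _ sF cx); apply: eq_bigr => nu _.
  by rewrite mxE [lsubmx _ _ _]mxE.
split=> [h xi w|h c xi w cx].
  by have [c cx] := dom_cover xi; rewrite (h c) // (E c).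
by rewrite h (E c).
Qed.

Lemma one_form_eq m (M : manifold R m) (eta theta : one_form M) :
  (forall p (v : tangent M p), eta p v = theta p v) -> eta = theta.
Proof.
case: eta theta => [f sf] [g sg] /= fg.
have E : f = g.
  by apply: functional_extensionality_dep => p; apply/funext => v; exact: fg.
by subst g; congr OneForm; exact: Prop_irrelevance.
Qed.

Lemma hilbert_form_exists_unique F : smooth_fun F ->
  exists! eta : one_form (TM Y), hilbert_form_of F eta.
Proof.
move=> sF; exists (OneForm (hilbert_val_smooth sF)); split.
  exact/(hilbert_form_ofP _ sF).
by move=> eta /(hilbert_form_ofP _ sF) h; apply: one_form_eq => p v; rewrite h.
Qed.

Lemma pullback_canonical_lift F (eta : one_form (TM Y)) (I : set R)
    (openI : open I) (zeta : open_line openI -> Y) :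
  smooth_fun F -> hilbert_form_of F eta -> homogeneous F ->
  differentiable_map (canonical_lift zeta) ->
  pullback (canonical_lift zeta) eta =
  (fun t (v : tangent (open_line openI) t) => F (canonical_lift zeta t) * dt v).
Proof.
move=> sF /(hilbert_form_ofP _ sF) etaE hF dl.
apply: functional_extensionality_dep => t; apply/funext => v.
rewrite /pullback etaE /hilbert_val.
have [c cx] := dom_cover (zeta t).
have dlt : diff_in (canonical_lift zeta) tt c t.
  exact: differentiable_map_diff_in.
rewrite (tangent_map_comp _ dlt (diff_in_TM_proj _)) //.
(* The tangent space of the line is spanned by d/dt. *)
have vE : v = tangent_scale (dt v) (ddt t).
  apply: (@tangent_eq _ _ (open_line openI) t v _ tt) => //.
  rewrite [RHS](_ : _ = dt v *: tcomp (ddt t) tt) // mk_tangentE //.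
  by apply/rowP => i; rewrite !mxE mulr1 ord1.
rewrite [in LHS]vE tangent_mapZ.
(* The projection of the lift is [zeta] by computation, so the direction is [dt v] times the lifted
   vector itself. *)
exact: (fiber_derive_radial (canonical_lift zeta t) (dt v) hF).
Qed.

End Hilbert.

(** * Descent to the Grassmann fibration *)

Section Projectable.
Context {R : realType} {n : nat} {Y : manifold R n}.
Implicit Types (F : TM Y -> R) (a : chart (G1 Y)) (g : G1 Y) (x : nonzeroTM Y).

Definition G1_proj g : Y := tag (sval (repr g)).

Lemma diff_in_G1_proj a g : dom a g ->
  @diff_in R _ _ (G1 Y) Y G1_proj a a.1.1 g.
Proof.
apply: diff_in_lsubmx => [q []//|q aq].
by rewrite [coord a q]/(scoord _ _) row_mxKl.
Qed.

Lemma tcomp_G1_proj a g (u : tangent (G1 Y) g) : dom a g ->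
  @tcomp _ _ Y _ (tangent_map G1_proj u) a.1.1 = lsubmx (tcomp u a).
Proof.
apply: tangent_map_lsubmx => [q []//|q aq].
by rewrite [coord a q]/(scoord _ _) row_mxKl.
Qed.

(** The chosen representative of a class differs from the given vector by a positive factor, which
    keeps the base point. *)
Lemma G1_proj_kappa : G1_proj \o @kappa R n Y = @TM_proj R n Y \o sval.
Proof.
apply/funext => x.
by have /pos_equivP[l _ []] := repr_pos_equiv x.
Qed.

(* The expression in charts of the section xi |-> xi / |xi^i| of kappa over the
   chart a = (c, i, b) of G^1 Y; see G1_liftE. *)
Definition G1_lift a (z : 'rV[R]_(n + n.-1)) : 'rV[R]_(n + n) :=
  row_mx (lsubmx z) (G1_vec a a z).

Definition normalized a g : TM Y :=
  TM_scale `|vec a.1.1 (repr g) 0 a.1.2|^-1 (sval (repr g)).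

Lemma G1_liftE a g : dom a g ->
  G1_lift a (coord a g) = coord (m := TM Y) a.1.1 (normalized a g).
Proof.
move=> ag; have [cg _] := ag.
by rewrite /G1_lift [coord a g]/(scoord _ _) G1_vecE // row_mxKl.
Qed.

Lemma Ck_G1_lift k a : Ck k (coord a @` dom a) (G1_lift a).
Proof.
have oU := @dom_image_open _ _ _ a.
apply: Ck_row_mx => //; first by apply: Ck_lsubmx => //; exact: Ck_id.
apply: Ck_sub (@Ck_G1_vec _ _ _ k a a).
move=> _ [g [cg _] <-]; exists (tag (sval (repr g))) => //.
by rewrite [coord a g]/(scoord _ _) row_mxKl.
Qed.

(** The choice made by [repr] need not be smooth in [g]; for smooth homogeneous [F], every vector of
    the class gives the same value. *)
Definition G1_val F g (u : tangent (G1 Y) g) : R :=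
  @fiber_derive R n Y F (sval (repr g)) (tangent_map G1_proj u).

(** By homogeneity the representative may be replaced by the normalized one, whose chart expression
    [G1_lift] is smooth; the coefficients are the fibre partials of [F] along it. *)
Fact G1_val_smooth F : smooth_fun F -> homogeneous F ->
  forall a, exists2 b : 'rV[R]_(n + n.-1) -> 'rV[R]_(n + n.-1),
    smooth (coord a @` dom a) b &
    forall g (u : tangent (G1 Y) g), dom a g ->
      G1_val F u = \sum_i b (coord a g) 0 i * tcomp u a 0 i.
Proof.
move=> sF hF a; have oU := @dom_image_open _ _ _ a.
exists (fun z => row_mx (fiber_partials F a.1.1 (G1_lift a z)) 0) => [k|g u ag].
  apply: Ck_row_mx => //; last exact: Ck_cst.
  have oV := @dom_image_open _ _ (TM Y) a.1.1.
  apply: (Ck_comp oU oV); last exact: smooth_fiber_partials.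
    move=> _ [g ag <-]; exists (normalized a g); last exact/esym/G1_liftE.
    by case: ag.
  exact: Ck_G1_lift.
have [cg _] := ag.
rewrite sum_row_mx0 G1_liftE // -(tcomp_G1_proj _ ag).
rewrite -(@fiber_derive_partials _ _ _ F a.1.1 (normalized a g)) //.
symmetry; apply: (fiber_derive_homogeneous sF hF _ erefl) => //.
by rewrite invr_gt0; exact: sdom_norm_gt0.
Qed.

Lemma diff_in_sval x (c : chart (TM Y)) : dom c (sval x) ->
  @diff_in R _ _ (nonzeroTM Y) (TM Y) sval c c x.
Proof.
move=> cx; have oU := @dom_image_open _ _ (nonzeroTM Y) c.
have H := @diff_in_model R _ _ (nonzeroTM Y) (TM Y) sval c c x _ id oU.
apply: (proj1 (H _ _ _ _ _ _)) => //.
by move=> y [q cq <-]; exists q.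
Qed.

Lemma diff_in_kappa x : exists a, [/\ dom (m := nonzeroTM Y) a.1.1 x,
  dom a (kappa x) & @diff_in R _ _ (nonzeroTM Y) (G1 Y) (@kappa R n Y) a.1.1 a x].
Proof.
have [[[c i] b] ax] : exists a : chart (G1 Y), sdom a x.
  have [a ar] := @dom_cover _ _ (G1 Y) (kappa x).
  by exists a; exact: sdom_pos_equiv (repr_pos_equiv x) ar.
have kd a q : sdom a q -> dom a (kappa q).
  by apply: sdom_pos_equiv; rewrite pos_equiv_sym repr_pos_equiv.
have kE a q : coord a (kappa q) = scoord a q.
  exact: scoord_pos_equiv (repr_pos_equiv q).
have [cx sx] := ax; exists (c, i, b); split; [exact: cx|exact: kd|].
(* On the domain of the chart (c, i, b), [s] is the absolute value of the i-th component, written as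
   a linear function. So [f] is the expression of [kappa], smooth where [s] is positive. *)
pose s (z : 'rV[R]_(n + n)) : R := (-1) ^+ b * z 0 (rshift n i).
pose f (z : 'rV[R]_(n + n)) : 'rV[R]_(n + n.-1) :=
  row_mx (lsubmx z) (col' i ((s z)^-1 *: rsubmx z)).
pose U : set 'rV[R]_(n + n) :=
  coord (m := TM Y) c @` dom (m := TM Y) c `&` [set z | 0 < s z].
have cs k A : open A -> Ck k A s.
  move=> oA; apply: (@Ck_mul _ _ k A (cst ((-1) ^+ b))) => //; first exact: Ck_cst.
  by apply: Ck_entry => //; exact: Ck_id.
have oU : open U.
  apply: openI; first exact: dom_image_open.
  rewrite openE => z sz.
  exact: (cvgr_gt _ (@cs 0%N _ openT z I) _ sz).
have cf k : Ck k U f.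
  apply: Ck_row_mx => //; first by apply: Ck_lsubmx => //; exact: Ck_id.
  apply: Ck_mx => // i0 j.
  rewrite (_ : (fun _ => _) =
      (fun z => (s z)^-1) * (fun z => z 0 (rshift n (lift i j)))); last first.
    by apply/funext => z; rewrite (ord1 i0) !fctE !mxE.
  apply: Ck_mul => //; last by apply: Ck_entry => //; exact: Ck_id.
  by apply: Ck_inv => [//|z [_ /= sz]|]; [rewrite gt_eqF|exact: cs].
have sE q : s (coord (m := nonzeroTM Y) c q) = (-1) ^+ b * vec c q 0 i.
  by rewrite /s row_mxEr.
have Ux : U (coord (m := nonzeroTM Y) c x).
  by split; [exists (sval x)|rewrite /= sE].
have H := @diff_in_model R _ _ (nonzeroTM Y) (G1 Y) (@kappa R n Y) c (c, i, b)
  x U f oU.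
apply: (proj1 (H _ _ _ _ _ _)) => //; first exact: kd.
(* Positivity of [s] also makes the vector with coordinates [y] nonzero and puts its class in the
   chart (c, i, b). *)
- move=> y [[xi cxi xiy] sy].
  have nz : nonzero xi.
    apply/(nonzeroE cxi); apply: contraTneq sy => v0.
    by rewrite /s -xiy /= /TM_coord row_mxEr v0 mxE mulr0 ltxx.
  exists (exist _ xi nz); split=> //; apply: kd; split=> //.
  by rewrite -sE; move: sy; rewrite -xiy.
- move=> q cq kq; rewrite kE.
  have aq : sdom (c, i, b) q by exact: sdom_pos_equiv (repr_pos_equiv q) kq.
  rewrite /scoord (sdom_norm aq) /f sE /=.
  by rewrite row_mxKl row_mxKr.
- by have [h _] := cf 1%N; exact: h.
Qed.

Lemma hilbert_form_projectable F (eta : one_form (TM Y)) :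
  smooth_fun F -> hilbert_form_of F eta -> homogeneous F -> projectable eta.
Proof.
move=> sF /(hilbert_form_ofP _ sF) etaE hF.
exists (OneForm (G1_val_smooth sF hF)).
apply: functional_extensionality_dep => x; apply/funext => v.
rewrite /pullback etaE /= /G1_val /hilbert_val.
have [a [cx ax ka]] := diff_in_kappa x.
(* The representative of the class of [x] is l times [x]; it remains to match the directions at
   these two vectors. *)
have [l l0 xl] := asboolW (repr_pos_equiv x).
apply: (fiber_derive_homogeneous sF hF l0 xl) => c.
rewrite (tangent_map_comp _ ka (diff_in_G1_proj ax)).
rewrite (tangent_map_comp _ (diff_in_sval cx) (diff_in_TM_proj cx)).
(* Both directions are now images of [v] under the tangent map of one and the same map to Y, in its
   two factorizations. *)
exact: (congr1 (fun f => tcomp (tangent_map f v) c) G1_proj_kappa).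
Qed.

End Projectable.

Theorem theorem2 (R : realType) (n : nat) (Y : manifold R n)
    (Y_hausdorff : hausdorff_space Y) (Y_countable : @second_countable Y) :
  (forall F : TM Y -> R, smooth_fun F ->
     exists! eta : one_form (TM Y), hilbert_form_of F eta) /\
  (forall (F : TM Y -> R) (eta : one_form (TM Y)),
     smooth_fun F -> hilbert_form_of F eta -> homogeneous F ->
     projectable eta) /\
  (forall (F : TM Y -> R) (eta : one_form (TM Y)),
     smooth_fun F -> hilbert_form_of F eta -> homogeneous F ->
     forall (I : set R) (openI : open I) (itvI : is_interval I)
       (zeta : open_line openI -> Y),
     differentiable_map zeta -> differentiable_map (canonical_lift zeta) ->
     pullback (canonical_lift zeta) eta =
     (fun t (v : tangent (open_line openI) t) =>
        F (canonical_lift zeta t) * dt v)).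
Proof.
split; first exact: hilbert_form_exists_unique.
split; first exact: hilbert_form_projectable.
move=> F eta sF eF hF I openI _ zeta _; exact: pullback_canonical_lift.
Qed.
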